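(* For any positive integer $q$ and any integers $p,m\ge 2$, the following two identities hold: $$\sum_{\substack{i+j=m-1\\ i,j\ge 0}}\binom{p+i-1}{i}\binom{q+j-1}{j}\zeta(p+i,q+j)-(-1)^q\sum_{\substack{i+j=p-1\\ i,j\ge 0}}\binom{m+i-1}{i}\binom{q+j-1}{j}\zeta(m+i,q+j)$$ $$=\sum_{\substack{i+j=q-1\\ i,j\ge 0}}(-1)^j\binom{m+i-1}{i}\binom{p+j-1}{j}\zeta(m+i)\zeta(p+j),$$ and $$\sum_{\substack{i+j=m-1\\ i,j\ge 0}}\binom{p+i-1}{i}\binom{q+j-1}{j}T(p+i,q+j)-(-1)^q\sum_{\substack{i+j=p-1\\ i,j\ge 0}}\binom{m+i-1}{i}\binom{q+j-1}{j}T(m+i,q+j)$$ $$=\sum_{\substack{i+j=q-1\\ i,j\ge 0}}(-1)^j\binom{m+i-1}{i}\binom{p+j-1}{j}T(m+i)T(p+j).$$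
   Context: For positive integers $k_1,\ldots,k_r$ with $k_1>1$, the multiple zeta values and multiple $T$-values are $$\zeta(k_1,\ldots,k_r)=\sum_{n_1>\cdots>n_r>0}\frac{1}{n_1^{k_1}\cdots n_r^{k_r}},\qquad T(k_1,\ldots,k_r)=\sum_{\substack{n_1>\cdots>n_r>0\\ n_j\equiv r+1-j\ (\mathrm{mod}\ 2)}}\frac{2^r}{n_1^{k_1}\cdots n_r^{k_r}}.$$ *)

(* Defs.v *)
From HB Require Import structures.
From mathcomp Require Import all_boot all_order all_algebra.
From mathcomp Require Import all_classical all_reals all_analysis.

Set Implicit Arguments.
Unset Strict Implicit.
Unset Printing Implicit Defensive.

Import Order.TTheory GRing.Theory Num.Theory.
Local Open Scope classical_set_scope.
Local Open Scope ring_scope.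

(* [n_1 > ... > n_r > 0]; the tuple component of index [i : 'I_r] is the
   n_{i+1} of the usual 1-based notation. *)
Definition decreasing_pos (r : nat) : set (r.-tuple nat) :=
  [set n | sorted gtn n /\ all (ltn 0%N) n].

(* The 1-based condition n_j = r + 1 - j mod 2, shifted to 0-based indices. *)
Definition alternating_parity (r : nat) : set (r.-tuple nat) :=
  [set n | forall i : 'I_r, (tnth n i = r - i %[mod 2])%N].

(* The terms are nonnegative, so the sum is taken in [\bar R]. It is finite
   when the k_i are positive and k_1 > 1, and then [fine] merely reads it in
   [R]; for divergent arguments [fine +oo = 0] is a junk value. *)
Definition mzv (R : realType) (r : nat) (k : r.-tuple nat) : R :=
  fine (\esum_(n in @decreasing_pos r)
          (1 / \prod_(i < r) (tnth n i)%:R ^+ tnth k i)%:E).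

Definition mtv (R : realType) (r : nat) (k : r.-tuple nat) : R :=
  fine (\esum_(n in @decreasing_pos r `&` @alternating_parity r)
          (2 ^+ r / \prod_(i < r) (tnth n i)%:R ^+ tnth k i)%:E).

(* Main.v *)
(* Put u = a - t and v = b + t, so that u + v = a + b does not depend on t.
   Expanding 1 / (u ^ m v ^ p) into partial fractions
   1 / ((u + v) ^ k u ^ l) and 1 / ((u + v) ^ k v ^ l), and extracting the
   coefficient of t ^ (q - 1), gives an identity between rational functions of a
   and b. Summing it over all positive integers a and b gives the statement for
   zeta values, with n_1 = a + b and n_2 = a (or b); summing over odd a and b
   gives it for T-values. As p, m >= 2, all the double series that occur have
   weight at least 4 and are dominated by the series of 1 / (a ^ 2 b ^ 2). *)
Require Import Defs.
From HB Require Import structures.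
From mathcomp Require Import all_boot all_order all_algebra.
From mathcomp Require Import all_classical all_reals all_analysis.
From mathcomp Require Import ring lra zify.

Set Implicit Arguments.
Unset Strict Implicit.
Unset Printing Implicit Defensive.

Import Order.TTheory GRing.Theory Num.Theory.
Import numFieldNormedType.Exports.
Local Open Scope classical_set_scope.
Local Open Scope ring_scope.

(** * Binomial convolutions and the partial fraction identity *)

Lemma sum_antidiagonal (V : nmodType) (n : nat) (F : nat -> nat -> V) :
  \sum_(i < n) \sum_(j < n | (i + j == n - 1)%N) F i j
  = \sum_(i < n) F i (n - i.+1)%N.
Proof.
apply: eq_bigr => i _; rewrite (big_pred1 (rev_ord i)) //= => j.
by rewrite inE -(inj_eq val_inj) /=; have := ltn_ord i; lia.
Qed.

Section BinomialConvolution.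
Variable F : fieldType.
Implicit Types (X Y : F) (n p q : nat).

(* The coefficient of [t ^ (n - 1)] in
   [(X / (1 - t X)) ^ p * (Y / (1 - t Y)) ^ q]; the truncated subtractions give
   ['C(0 + i - 1, i) = (i == 0)], as they should. *)
Definition bin_conv n p q X Y : F :=
  \sum_(i < n) \sum_(j < n | (i + j == n - 1)%N)
    'C(p + i - 1, i)%:R * 'C(q + j - 1, j)%:R * (X ^+ (p + i) * Y ^+ (q + j)).

Lemma bin_convC n p q X Y : bin_conv n p q X Y = bin_conv n q p Y X.
Proof.
rewrite /bin_conv (exchange_big_dep xpredT) //=; apply: eq_bigr => i _.
by apply: eq_big => [j|j _]; [rewrite addnC | ring].
Qed.

(** The series [f = X / (1 - t X)] satisfies [f = X (1 + t f)], so
    [f ^ (p + 1) = X (f ^ p + t f ^ (p + 1))]. Comparing coefficients of [t ^ n] gives the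
    recurrence, which on the level of binomials is Pascal's rule. *)
Lemma bin_convSl n p q X Y :
  bin_conv n.+1 p.+1 q X Y
  = X * (bin_conv n.+1 p q X Y + bin_conv n p.+1 q X Y).
Proof.
rewrite /bin_conv !(sum_antidiagonal _ (fun i j => 'C(_ + i - 1, i)%:R
  * 'C(q + j - 1, j)%:R * (X ^+ (_ + i) * Y ^+ (q + j)))).
rewrite !big_ord_recl -addrA mulrDr; congr (_ + _).
  by rewrite !bin0 !addn0 exprS; ring.
rewrite -big_split mulr_sumr; apply: eq_bigr => i _.
rewrite !lift0 !addSn !addnS !subSS !subn0.
rewrite subn1 /= binS natrD !exprS.
ring.
Qed.

Lemma bin_convSr n p q X Y :
  bin_conv n.+1 p q.+1 X Y
  = Y * (bin_conv n.+1 p q X Y + bin_conv n p q.+1 X Y).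
Proof.
by rewrite bin_convC bin_convSl !(bin_convC _ q) !(bin_convC _ q.+1).
Qed.

Lemma bin_conv0 p q X Y : bin_conv 0 p q X Y = 0.
Proof. exact: big_ord0. Qed.

Lemma bin_conv_0l n q X Y :
  bin_conv n.+1 0 q X Y = 'C(q + n - 1, n)%:R * Y ^+ (q + n).
Proof.
rewrite /bin_conv (sum_antidiagonal _ (fun i j => 'C(0 + i - 1, i)%:R
  * 'C(q + j - 1, j)%:R * (X ^+ (0 + i) * Y ^+ (q + j)))).
rewrite big_ord_recl big1 ?addr0 /= ?bin0 ?subn1 /= ?expr0 ?mul1r //.
by move=> i _; rewrite bin_small ?mul0r //= /bump; lia.
Qed.

(* Both sides are the coefficient of [t ^ (q - 1)] in the partial fraction
   decomposition of [1 / (u ^ m v ^ p)], where [u = a - t] and [v = b + t],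
   with respect to [u + v = a + b]. *)
Lemma partial_fraction (a b : F) (q m p : nat) :
  a != 0 -> b != 0 -> a + b != 0 -> (0 < q)%N -> (0 < m + p)%N ->
  bin_conv m p q (a + b)^-1 a^-1 - (-1) ^+ q * bin_conv p m q (a + b)^-1 b^-1
  = (-1) ^+ p * bin_conv q m p a^-1 (- b^-1).
Proof.
move=> a0 b0 s0; case: q => // q _.
(* Induction on [m], then on [p]. When one of them is 0, one convolution on the left is empty and
   each of the other two has a single nonzero term; these agree by the symmetry of binomial
   coefficients. *)
elim: m p => [|m IHm] p.
  case: p => // p _; rewrite bin_conv0 !bin_conv_0l.
  have -> : 'C(p.+1 + q - 1, q) = 'C(q.+1 + p - 1, p).
    by rewrite !addSn !subn1 /= addnC -[in RHS](bin_sub (leq_addl q p)) addnK.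
  rewrite -[- b^-1]mulN1r exprMn [X in _ = X]mulrCA [X in _ = _ * X]mulrA.
  rewrite -exprD addnA addnn.
  rewrite -(signr_odd _ (_.*2 + q)) oddD odd_double signr_odd.
  by rewrite (addnC p.+1 q) addSnnS exprS; ring.
elim: p => [|p IHp] _.
  rewrite bin_conv0 mulr0 subr0 expr0 mul1r bin_conv_0l bin_convC bin_conv_0l.
  rewrite (_ : 'C(q.+1 + m - 1, m) = 'C(m.+1 + q - 1, q)).
    by rewrite addSnnS addnC.
  by rewrite !addSn !subn1 /= addnC -[in RHS](bin_sub (leq_addl m q)) addnK.
(* Multiplication by [a + b] turns the claim at [(m.+1, p.+1)] into a combination of those at
   [(m, p.+1)] and [(m.+1, p)]. *)
apply: (mulfI s0).
have step n k (x : F) : bin_conv n.+1 k.+1 q.+1 (a + b)^-1 x * (a + b)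
   = bin_conv n.+1 k q.+1 (a + b)^-1 x + bin_conv n k.+1 q.+1 (a + b)^-1 x.
  by rewrite bin_convSl mulrC mulrA divff // mul1r.
(* The left recurrence absorbs the factor [a] and the right one the factor [b]. Each leaves a term
   [bin_conv q m.+1 p.+1], and these two cancel because the last argument is [- b^-1]. *)
have -> : (a + b) * ((-1) ^+ p.+1 * bin_conv q.+1 m.+1 p.+1 a^-1 (- b^-1))
   = (-1) ^+ p.+1 * bin_conv q.+1 m p.+1 a^-1 (- b^-1)
     + (-1) ^+ p * bin_conv q.+1 m.+1 p a^-1 (- b^-1).
  rewrite mulrDl {1}bin_convSl (bin_convSr q m.+1) !exprS.
  by field; rewrite a0 b0.
rewrite -IHm ?addnS // -IHp // [LHS]mulrC mulrBl step -mulrA step.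
ring.
Qed.
End BinomialConvolution.

(** * Sums of nonnegative families as limits of finite sums *)

(** Every finite set of indices lies in some [A n], so for nonnegative terms the full sum is the
    supremum of the nondecreasing sequence of sums over [A n]. The bound [M] makes it finite, so
    that [fine] returns its true value. *)
Lemma cvg_esum (R : realType) (I : choiceType) (A : nat -> seq I)
    (f : I -> R) (M : R) :
  (forall n, uniq (A n)) ->
  (forall m n, (m <= n)%N -> {subset A m <= A n}) ->
  (forall i, exists n, i \in A n) ->
  (forall i, 0 <= f i) ->
  (forall n, \sum_(i <- A n) f i <= M) ->
  (fun n => \sum_(i <- A n) f i) @ \oo
    --> fine (\esum_(i in [set: I]) (f i)%:E).
Proof.
move=> uA subA coverA f0 boundA; set u := fun n => \sum_(i <- A n) f i.
have uE n : (u n)%:E = (\sum_(i \in [set` A n]) (f i)%:E)%E.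
  by rewrite -fsbig_seq // sumEFin.
have ndu : nondecreasing_seq u.
  move=> m n mn; rewrite -lee_fin !uE; apply: lee_fsum_nneg_subset => //.
    by move=> i; rewrite !inE /=; exact: subA.
  by move=> i _; rewrite lee_fin.
have ubu : has_ubound (range u) by exists M => _ [n _ <-]; exact: boundA.
suff -> : \esum_(i in [set: I]) (f i)%:E = (sup (range u))%:E.
  exact: nondecreasing_cvgn.
apply/eqP; rewrite eq_le; apply/andP; split.
  apply: ge_ereal_sup => _ [X [finX _] <-].
  have [s Xs] := (finite_seqP X).1 finX.
  have [n sAn] : exists n, {subset s <= A n}.
    elim: s {Xs} => [|i s [n sn]]; first by exists 0%N.
    have [k ik] := coverA i; exists (maxn n k) => j.
    rewrite inE => /predU1P[->|js].
      exact: subA (leq_maxr _ _) _ ik.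
    exact: subA (leq_maxl _ _) _ (sn _ js).
  apply: (@le_trans _ _ (u n)%:E).
    rewrite uE; apply: lee_fsum_nneg_subset => //.
      by move=> i; rewrite Xs !inE /=; exact: sAn.
    by move=> i _; rewrite lee_fin.
  by rewrite lee_fin; apply: ub_le_sup => //; exists n.
have e0 : (0 <= \esum_(i in [set: I]) (f i)%:E)%E.
  by apply: esum_ge0 => i _; rewrite lee_fin.
have ule n : ((u n)%:E <= \esum_(i in [set: I]) (f i)%:E)%E.
  by apply: esum_ge; exists [set` A n]; rewrite ?uE.
case: (\esum_(i in _) _) e0 ule => [r| |] // _ ule; last by rewrite leey.
rewrite lee_fin; apply: ge_sup; first by exists (u 0%N); exists 0%N.
by move=> _ [n _ <-]; rewrite -lee_fin.
Qed.

Lemma sum_ord_iota (V : nmodType) (n : nat) (f : nat -> V) :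
  \sum_(i < n) f i = \sum_(i <- iota 0 n) f i.
Proof. by rewrite -(big_mkord xpredT f) /index_iota subn0. Qed.

(** * Limits of double sums truncated to squares *)

(** Squares are invariant under exchanging [a] and [b], and the sum of [f a * g b] over a square is
    exactly a product of two partial sums; both facts are used in passing to the limit. *)
Definition square_sum (V : nmodType) (f : nat -> nat -> V) (n : nat) : V :=
  \sum_(a < n) \sum_(b < n) f a b.

Lemma square_sum_sum (V : nmodType) (I : Type) (r : seq I) (P : pred I)
    (f : I -> nat -> nat -> V) (n : nat) :
  square_sum (fun a b => \sum_(i <- r | P i) f i a b) n
  = \sum_(i <- r | P i) square_sum (f i) n.
Proof.
rewrite /square_sum [RHS]exchange_big; apply: eq_bigr => a _.
by rewrite [RHS]exchange_big.
Qed.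

Section SquareSumLimits.
Variable R : realType.

Lemma cvg_square_sumZ (k : R) (f : nat -> nat -> R) (s : R) :
  square_sum f @ \oo --> s ->
  square_sum (fun a b => k * f a b) @ \oo --> k * s.
Proof.
move=> fs; rewrite (_ : square_sum _ = (cst k) \* square_sum f).
  by apply: cvgM fs; exact: cvg_cst.
apply/funext => n; rewrite /= /square_sum mulr_sumr.
by apply: eq_bigr => a _; rewrite mulr_sumr.
Qed.

Lemma cvg_square_sumD (f g : nat -> nat -> R) (s t : R) :
  square_sum f @ \oo --> s -> square_sum g @ \oo --> t ->
  square_sum (fun a b => f a b + g a b) @ \oo --> s + t.
Proof.
move=> fs gt; rewrite (_ : square_sum _ = square_sum f \+ square_sum g).
  exact: cvgD.
apply/funext => n; rewrite /= /square_sum -big_split /=.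
by apply: eq_bigr => a _; rewrite big_split.
Qed.

Lemma cvg_square_sum_sum (I : Type) (r : seq I) (P : pred I)
    (f : I -> nat -> nat -> R) (s : I -> R) :
  (forall i, P i -> square_sum (f i) @ \oo --> s i) ->
  square_sum (fun a b => \sum_(i <- r | P i) f i a b) @ \oo
    --> \sum_(i <- r | P i) s i.
Proof.
move=> fs; rewrite (_ : square_sum _ =
    (fun n => \sum_(i <- r | P i) square_sum (f i) n)).
  by apply: cvg_big => //; exact: add_continuous.
by apply/funext => n; rewrite square_sum_sum.
Qed.

Lemma cvg_square_sum_swap (f : nat -> nat -> R) (s : R) :
  square_sum f @ \oo --> s -> square_sum (fun a b => f b a) @ \oo --> s.
Proof.
rewrite (_ : square_sum (fun a b => f b a) = square_sum f) //.
by apply/funext => n; exact: exchange_big.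
Qed.

Lemma cvg_square_sumM (f g : nat -> R) (s t : R) :
  (fun n => \sum_(a < n) f a) @ \oo --> s ->
  (fun n => \sum_(b < n) g b) @ \oo --> t ->
  square_sum (fun a b => f a * g b) @ \oo --> s * t.
Proof.
move=> fs gt; rewrite (_ : square_sum _ =
    (fun n => \sum_(a < n) f a) \* (fun n => \sum_(b < n) g b)).
  exact: cvgM.
by apply/funext => n; rewrite /= big_distrlr.
Qed.

Lemma cvg_square_sum_esum (f : nat -> nat -> R) (M : R) :
  (forall a b, 0 <= f a b) -> (forall n, square_sum f n <= M) ->
  square_sum f @ \oo
    --> fine (\esum_(ab in [set: nat * nat]) (f ab.1 ab.2)%:E).
Proof.
move=> f0 fM; pose A n := [seq (a, b) | a <- iota 0 n, b <- iota 0 n].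
have uE : square_sum f = fun n => \sum_(ab <- A n) f ab.1 ab.2.
  apply/funext => n; rewrite big_allpairs.
  rewrite -(sum_ord_iota n (fun a => \sum_(b <- iota 0 n) f a b)).
  by apply: eq_bigr => a _; rewrite (sum_ord_iota n (f a)).
rewrite uE.
apply: (@cvg_esum _ _ _ (fun ab : nat * nat => f ab.1 ab.2) M) => //.
- by move=> n; apply: allpairs_uniq; rewrite ?iota_uniq // => -[? ?] [].
- move=> m n mn [a b] /allpairsP[[? ?] /= [+ + ->]].
  by rewrite !mem_iota => am bm; apply: allpairs_f; rewrite mem_iota; lia.
- move=> [a b]; exists (maxn a b).+1; apply: allpairs_f; rewrite mem_iota; lia.
- by move=> n; rewrite -(congr1 (@^~ n) uE).
Qed.

Lemma cvg_sum_esum (f : nat -> R) (M : R) :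
  (forall a, 0 <= f a) -> (forall n, \sum_(a < n) f a <= M) ->
  (fun n => \sum_(a < n) f a) @ \oo
    --> fine (\esum_(a in [set: nat]) (f a)%:E).
Proof.
move=> f0 fM.
have uE : (fun n => \sum_(a < n) f a) = fun n => \sum_(a <- iota 0 n) f a.
  by apply/funext => n; exact: sum_ord_iota.
rewrite uE; apply: (@cvg_esum _ _ _ f M) => //.
- by move=> n; exact: iota_uniq.
- by move=> m n mn a; rewrite !mem_iota; lia.
- by move=> a; exists a.+1; rewrite mem_iota; lia.
- by move=> n; rewrite -(congr1 (@^~ n) uE).
Qed.

End SquareSumLimits.

(** * From the partial fraction identity to an identity of limits *)

Section ShuffleIdentity.
Variable R : realType.

(* With [a] and [b] ranging over the positive integers congruent to 1 mod c, the
   indices of the double sum are [n_1 = a + b] and [n_2 = a]; the cases [c = 1]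
   and [c = 2] are the zeta values and the T-values, and [c ^ r] is exactly the
   normalising factor. *)
Definition single_term (c k a : nat) : R := c%:R / (c * a + 1)%:R ^+ k.

Definition double_term (c k l a b : nat) : R :=
  c%:R ^+ 2 / ((c * (a + b) + 2)%:R ^+ k * (c * a + 1)%:R ^+ l).

(** The two sides are limits of the same square sums, since their terms agree for each [a] and [b]
    by [partial_fraction]. Keeping [c] general treats zeta values and T-values at once. *)
Lemma shuffle_of_cvg (c : nat) (Z1 : nat -> R) (Z2 : nat -> nat -> R) :
  (forall k, (2 <= k)%N ->
    (fun n => \sum_(a < n) single_term c k a) @ \oo --> Z1 k) ->
  (forall k l, (2 <= k)%N -> (1 <= l)%N -> (4 <= k + l)%N ->
    square_sum (double_term c k l) @ \oo --> Z2 k l) ->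
  forall q p m : nat, (0 < q)%N -> (2 <= p)%N -> (2 <= m)%N ->
  (\sum_(i < m) \sum_(j < m | (i + j == m - 1)%N)
      'C(p + i - 1, i)%:R * 'C(q + j - 1, j)%:R * Z2 (p + i)%N (q + j)%N)
  - (-1) ^+ q *
    (\sum_(i < p) \sum_(j < p | (i + j == p - 1)%N)
        'C(m + i - 1, i)%:R * 'C(q + j - 1, j)%:R * Z2 (m + i)%N (q + j)%N)
  = \sum_(i < q) \sum_(j < q | (i + j == q - 1)%N)
      (-1) ^+ j * 'C(m + i - 1, i)%:R * 'C(p + j - 1, j)%:R
        * Z1 (m + i)%N * Z1 (p + j)%N.
Proof.
move=> cvg1 cvg2 q p m q0 p2 m2.
pose x a : R := (c * a + 1)%:R.
have x0 a : x a != 0 by rewrite pnatr_eq0; lia.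
have xD a b : x a + x b = (c * (a + b) + 2)%:R.
  by rewrite -natrD; congr _%:R; lia.
have s0 a b : x a + x b != 0 by rewrite xD pnatr_eq0; lia.
(* The second double term takes [b a] because the second convolution in [partial_fraction] involves
   the inverse of [x b]; the limit is unaffected by this exchange. *)
pose lhs a b : R :=
  (\sum_(i < m) \sum_(j < m | (i + j == m - 1)%N)
      'C(p + i - 1, i)%:R * 'C(q + j - 1, j)%:R
        * double_term c (p + i) (q + j) a b)
  + - (-1) ^+ q *
    (\sum_(i < p) \sum_(j < p | (i + j == p - 1)%N)
        'C(m + i - 1, i)%:R * 'C(q + j - 1, j)%:R
          * double_term c (m + i) (q + j) b a).
pose rhs a b : R := \sum_(i < q) \sum_(j < q | (i + j == q - 1)%N)
      (-1) ^+ j * 'C(m + i - 1, i)%:R * 'C(p + j - 1, j)%:R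
        * (single_term c (m + i) a * single_term c (p + j) b).
have lhs_rhs : lhs = rhs.
  apply/funext => a; apply/funext => b.
  have lhs1 n k a' b' : x a' + x b' = x a + x b ->
      \sum_(i < n) \sum_(j < n | (i + j == n - 1)%N)
        'C(k + i - 1, i)%:R * 'C(q + j - 1, j)%:R
          * double_term c (k + i) (q + j) a' b'
      = c%:R ^+ 2 * bin_conv n k q (x a + x b)^-1 (x a')^-1.
    move=> <-; rewrite /bin_conv mulr_sumr; apply: eq_bigr => i _.
    rewrite mulr_sumr; apply: eq_bigr => j _.
    by rewrite /double_term -xD -/(x a') invfM !exprVn; ring.
  rewrite /lhs lhs1 // (lhs1 _ _ b a (addrC _ _)) mulrCA -mulrDr mulNr.
  rewrite partial_fraction //; last by lia.
  rewrite /rhs /bin_conv 2!mulr_sumr; apply: eq_bigr => i _.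
  rewrite 2!mulr_sumr; apply: eq_bigr => j _.
  rewrite /single_term -/(x a) -/(x b) !exprVn -[- (x b)^-1]mulN1r exprMn.
  rewrite exprVn [(-1) ^+ (p + j)]exprD.
  (* The factor [(-1) ^+ p] of the partial fraction identity cancels against the one in
     [(-1) ^+ (p + j)], leaving [(-1) ^+ j]. *)
  have sgn : (-1) ^+ p * (-1) ^+ p = 1 :> R.
    by rewrite -expr2 sqrr_sign.
  transitivity ((-1) ^+ p * (-1) ^+ p * ((-1) ^+ j * 'C(m + i - 1, i)%:R
    * 'C(p + j - 1, j)%:R * (c%:R / x a ^+ (m + i) * (c%:R / x b ^+ (p + j))))).
    ring.
  by rewrite sgn mul1r.
apply: (@cvg_unique R _ (square_sum lhs @ \oo)) => //.
  rewrite -mulNr; apply: cvg_square_sumD; last apply: cvg_square_sumZ.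
    apply: cvg_square_sum_sum => i _; apply: cvg_square_sum_sum => j /eqP ij.
    (* By [ij] the weight [(p + i) + (q + j)] is [p + q + m - 1], hence at least 4. *)
    by apply: cvg_square_sumZ; apply: cvg2; lia.
  apply: cvg_square_sum_sum => i _; apply: cvg_square_sum_sum => j /eqP ij.
  apply: cvg_square_sumZ; apply: (cvg_square_sum_swap (f := double_term c _ _)).
  by apply: cvg2; lia.
rewrite lhs_rhs.
apply: cvg_square_sum_sum => i _; apply: cvg_square_sum_sum => j _.
rewrite -[_ * Z1 _ * _]mulrA; apply: cvg_square_sumZ.
by apply: cvg_square_sumM; apply: cvg1; lia.
Qed.

(** * Domination and convergence of the series *)

Lemma sum_inv_sqr_le (n : nat) : \sum_(a < n) (a.+1%:R ^+ 2)^-1 <= 2 :> R.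
Proof.
case: n => [|n]; first by rewrite big_ord0.
(* The sharper bound passes through the induction, since [1 / (y + 1) ^ 2 <= 1 / y - 1 / (y + 1)]
   for positive [y]. *)
suff : \sum_(a < n.+1) (a.+1%:R ^+ 2)^-1 <= 2 - n.+1%:R^-1 :> R.
  by move=> /le_trans; apply; rewrite gerBl invr_ge0.
elim: n => [|n IHn]; first by rewrite big_ord1 expr1n invr1; lra.
rewrite big_ord_recr /= (le_trans (lerD IHn (lexx _))) //.
have n0 : 0 < n.+1%:R :> R by rewrite ltr0n.
rewrite -[n.+2]addn1 natrD; set y := n.+1%:R in n0 *.
have -> : 2 - y^-1 + ((y + 1) ^+ 2)^-1 = 2 - (y + 1)^-1 - (y * (y + 1) ^+ 2)^-1.
  by field; rewrite !gt_eqF // addr_gt0.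
by rewrite gerBl invr_ge0 mulr_ge0 ?exprn_ge0 ?ltW // addr_gt0.
Qed.

Lemma inv_exprn_le_sqr (c k a : nat) : (0 < c)%N -> (2 <= k)%N ->
  ((c * a + 1)%:R ^+ k)^-1 <= (a.+1%:R ^+ 2)^-1 :> R.
Proof.
move=> c0 k2; rewrite lef_pV2 ?posrE ?exprn_gt0 ?ltr0n //; last lia.
rewrite -!natrX ler_nat -(subnK k2) expnD.
apply: (@leq_trans ((c * a + 1) ^ 2)); first by rewrite leq_exp2r //; nia.
by rewrite leq_pmull // expn_gt0; lia.
Qed.

Lemma sum_single_term_le (c k n : nat) : (0 < c)%N -> (2 <= k)%N ->
  \sum_(a < n) single_term c k a <= c%:R * 2.
Proof.
move=> c0 k2; rewrite -mulr_sumr ler_wpM2l //.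
apply: le_trans (sum_inv_sqr_le n); apply: ler_sum => a _.
exact: inv_exprn_le_sqr.
Qed.

(* Since [a + b] dominates both [a] and [b], each term is at most
   [c ^ 2 / (a ^ 2 * b ^ 2)]. *)
Lemma square_sum_double_term_le (c k l n : nat) :
  (0 < c)%N -> (2 <= k)%N -> (1 <= l)%N -> (4 <= k + l)%N ->
  square_sum (double_term c k l) n <= (c%:R * 2) ^+ 2.
Proof.
move=> c0 k2 l1 kl.
have S0 : 0 <= \sum_(a < n) single_term c 2 a.
  by apply: sumr_ge0 => a _; rewrite divr_ge0 // exprn_ge0.
apply: (@le_trans _ _ ((\sum_(a < n) single_term c 2 a) ^+ 2)); last first.
  by rewrite lerXn2r ?nnegrE ?mulr_ge0 // sum_single_term_le.
rewrite expr2 big_distrlr; apply: ler_sum => a _; apply: ler_sum => b _.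
rewrite /= /single_term /double_term mulrACA -expr2 -invfM.
rewrite ler_wpM2l ?exprn_ge0 //.
rewrite lef_pV2 ?posrE ?mulr_gt0 ?exprn_gt0 ?ltr0n //; try lia.
(* Two of the [k] factors [c * (a + b) + 2] dominate [(c * b + 1) ^ 2]; the other [k - 2], with the
   [l] factors [c * a + 1], dominate [(c * a + 1) ^ 2] because [k - 2 + l >= 2]. *)
rewrite -!natrX -!natrM ler_nat -(subnK k2) expnD mulnAC.
apply: leq_mul; last by rewrite leq_exp2r //; nia.
apply: (@leq_trans ((c * a + 1) ^ (k - 2 + l))).
  by rewrite leq_pexp2l //; lia.
rewrite expnD leq_mul //; case: (k - 2)%N => // e.
by rewrite leq_exp2r //; nia.
Qed.

Lemma cvg_single_term (c k : nat) : (0 < c)%N -> (2 <= k)%N ->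
  (fun n => \sum_(a < n) single_term c k a) @ \oo
    --> fine (\esum_(a in [set: nat]) (single_term c k a)%:E).
Proof.
move=> c0 k2; apply: (@cvg_sum_esum _ _ (c%:R * 2)) => [a|n].
  by rewrite divr_ge0 // exprn_ge0.
exact: sum_single_term_le.
Qed.

Lemma cvg_double_term (c k l : nat) :
  (0 < c)%N -> (2 <= k)%N -> (1 <= l)%N -> (4 <= k + l)%N ->
  square_sum (double_term c k l) @ \oo
    --> fine (\esum_(ab in [set: nat * nat]) (double_term c k l ab.1 ab.2)%:E).
Proof.
move=> c0 k2 l1 kl.
apply: (@cvg_square_sum_esum _ _ ((c%:R * 2) ^+ 2)) => [a b|n].
  by rewrite divr_ge0 ?mulr_ge0 ?exprn_ge0.
exact: square_sum_double_term_le.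
Qed.

End ShuffleIdentity.

(** * Parametrisation of the summation indices *)

Definition single_index (c a : nat) : 1.-tuple nat := [tuple (c * a + 1)%N].

Definition double_index (c : nat) (ab : nat * nat) : 2.-tuple nat :=
  [tuple (c * (ab.1 + ab.2) + 2)%N; (c * ab.1 + 1)%N].

Lemma single_index_inj (c : nat) : (0 < c)%N -> injective (single_index c).
Proof. by move=> c0 a a' [] /eqP; rewrite eqn_add2r eqn_pmul2l // => /eqP. Qed.

Lemma double_index_inj (c : nat) : (0 < c)%N -> injective (double_index c).
Proof.
move=> c0 [a b] [a' b'] [] /= /eqP + /eqP.
rewrite !eqn_add2r !eqn_pmul2l // => /eqP ab /eqP aa'.
by rewrite -aa' in ab *; congr (_, _); lia.
Qed.

Lemma double_index_decreasing (c : nat) (ab : nat * nat) :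
  decreasing_pos (double_index c ab).
Proof.
by split; rewrite /= ?andbT /gtn /= ?addn_gt0 ?orbT //; nia.
Qed.

Lemma single_index_bij1 :
  set_bij [set: nat] (@decreasing_pos 1) (single_index 1).
Proof.
split; first by move=> a _; split; rewrite //= addn1.
  by move=> a a' _ _; exact: single_index_inj.
case=> -[|x [|y s]] //= sz [_ /= /andP[x0 _]].
by exists x.-1 => //; apply: val_inj; congr [:: _]; lia.
Qed.

Lemma single_index_bij2 :
  set_bij [set: nat] (@decreasing_pos 1 `&` @alternating_parity 1)
    (single_index 2).
Proof.
split; last 2 first.
- by move=> a a' _ _; exact: single_index_inj.
- case=> -[|x [|y s]] //= sz [[_ /= /andP[x0 _]] /(_ ord0)].
  rewrite (tnth_nth 0%N) /= => xodd.
  by exists x./2 => //; apply: val_inj; congr [:: _]; lia.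
move=> a _; split; first by split; rewrite //= addn1.
by move=> i; rewrite (ord1 i) (tnth_nth 0%N) /=; lia.
Qed.

Lemma double_index_bij1 :
  set_bij [set: nat * nat] (@decreasing_pos 2) (double_index 1).
Proof.
split; first by move=> ab _; exact: double_index_decreasing.
  by move=> ab ab' _ _; exact: double_index_inj.
case=> -[|x [|y [|z s]]] //= sz [/= + /and3P[x0 y0 _]].
rewrite andbT /gtn /= => yx.
by exists (y.-1, (x - y).-1) => //; apply: val_inj; congr [:: _; _] => /=; lia.
Qed.

Lemma double_index_bij2 :
  set_bij [set: nat * nat] (@decreasing_pos 2 `&` @alternating_parity 2)
    (double_index 2).
Proof.
split; last 2 first.
- by move=> ab ab' _ _; exact: double_index_inj.
- case=> -[|x [|y [|z s]]] //= sz [[/= + /and3P[x0 y0 _]] par].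
  rewrite andbT /gtn /= => yx.
  have := par ord_max; have := par ord0; rewrite !(tnth_nth 0%N) /= => x2 y2.
  (* Here [x] is even and [y] odd, so [y] and [x - y] are both odd, and halving recovers [a] from
     [2 a + 1] and [b] from [2 b + 1]. *)
  exists (y./2, (x - y)./2) => //.
  by apply: val_inj; congr [:: _; _] => /=; lia.
move=> ab _; split; first exact: double_index_decreasing.
by move=> [[|[|i]] lti] //; rewrite (tnth_nth 0%N) /=; lia.
Qed.

(** * Zeta values and T-values as sums over the parameters *)

Section Values.
Variable R : realType.

Lemma mzv1E (k : nat) : mzv R [tuple k]
  = fine (\esum_(a in [set: nat]) (single_term R 1 k a)%:E).
Proof.
rewrite /mzv (@reindex_esum _ _ _ _ _ _ _ single_index_bij1); congr fine.
by apply: eq_esum => a _; rewrite big_ord1 !(tnth_nth 0%N).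
Qed.

Lemma mtv1E (k : nat) : mtv R [tuple k]
  = fine (\esum_(a in [set: nat]) (single_term R 2 k a)%:E).
Proof.
rewrite /mtv (@reindex_esum _ _ _ _ _ _ _ single_index_bij2); congr fine.
by apply: eq_esum => a _; rewrite big_ord1 !(tnth_nth 0%N).
Qed.

Lemma mzv2E (k l : nat) : mzv R [tuple k; l]
  = fine (\esum_(ab in [set: nat * nat]) (double_term R 1 k l ab.1 ab.2)%:E).
Proof.
rewrite /mzv (@reindex_esum _ _ _ _ _ _ _ double_index_bij1); congr fine.
apply: eq_esum => ab _; rewrite big_ord_recl big_ord1 !(tnth_nth 0%N) /=.
by rewrite /double_term expr1n.
Qed.

Lemma mtv2E (k l : nat) : mtv R [tuple k; l]
  = fine (\esum_(ab in [set: nat * nat]) (double_term R 2 k l ab.1 ab.2)%:E).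
Proof.
rewrite /mtv (@reindex_esum _ _ _ _ _ _ _ double_index_bij2); congr fine.
by apply: eq_esum => ab _; rewrite big_ord_recl big_ord1 !(tnth_nth 0%N) /=.
Qed.

End Values.

Theorem theorem3p1 (R : realType) (q p m : nat)
    (hq : (0 < q)%N) (hp : (2 <= p)%N) (hm : (2 <= m)%N) :
    ((\sum_(i < m) \sum_(j < m | (i + j == m - 1)%N)
            'C(p + i - 1, i)%:R * 'C(q + j - 1, j)%:R
              * mzv R [tuple (p + i)%N; (q + j)%N])
       - (-1) ^+ q *
         (\sum_(i < p) \sum_(j < p | (i + j == p - 1)%N)
            'C(m + i - 1, i)%:R * 'C(q + j - 1, j)%:R
              * mzv R [tuple (m + i)%N; (q + j)%N])
     = \sum_(i < q) \sum_(j < q | (i + j == q - 1)%N)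
         (-1) ^+ j * 'C(m + i - 1, i)%:R * 'C(p + j - 1, j)%:R
           * mzv R [tuple (m + i)%N] * mzv R [tuple (p + j)%N])
  /\
    ((\sum_(i < m) \sum_(j < m | (i + j == m - 1)%N)
            'C(p + i - 1, i)%:R * 'C(q + j - 1, j)%:R
              * mtv R [tuple (p + i)%N; (q + j)%N])
       - (-1) ^+ q *
         (\sum_(i < p) \sum_(j < p | (i + j == p - 1)%N)
            'C(m + i - 1, i)%:R * 'C(q + j - 1, j)%:R
              * mtv R [tuple (m + i)%N; (q + j)%N])
     = \sum_(i < q) \sum_(j < q | (i + j == q - 1)%N)
         (-1) ^+ j * 'C(m + i - 1, i)%:R * 'C(p + j - 1, j)%:R
           * mtv R [tuple (m + i)%N] * mtv R [tuple (p + j)%N]).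
Proof.
split.
  apply: (@shuffle_of_cvg R 1 (fun k => mzv R [tuple k])
    (fun k l => mzv R [tuple k; l])) => // [k k2|k l k2 l1 kl].
    by rewrite mzv1E; exact: cvg_single_term.
  by rewrite mzv2E; exact: cvg_double_term.
apply: (@shuffle_of_cvg R 2 (fun k => mtv R [tuple k])
  (fun k l => mtv R [tuple k; l])) => // [k k2|k l k2 l1 kl].
  by rewrite mtv1E; exact: cvg_single_term.
by rewrite mtv2E; exact: cvg_double_term.
Qed.
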